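(* Let $R$ be a commutative ring and $M$ a nonzero finitely generated multiplication $R$-module. Then the following statements are all equivalent (in each item, the listed variants are also equivalent to one another): (1) $M$ is weakly-morphic and reduced; $M$ is morphic and reduced; (2) $R/\mathrm{Ann}_R(M)$ is a regular ring; (3) $M$ is weakly-endoregular; $M$ is endoregular; (4) $M$ is endoregular; $M$ is Abelian endoregular; (5) $M$ is JT-regular; $M$ is weakly JT-regular; (6) $M$ is almost locally simple; (7) $M$ is F-regular; $M$ is strongly F-regular; (8) every cyclic submodule of $M$ has property $P$, where $P$ is any one (fixed) of: ''weakly-morphic and reduced'', ''morphic and reduced'', ''weakly-endoregular'', ''endoregular'', ''Abelian endoregular'', ''co-reduced'', ''JT-regular'', ''weakly JT-regular'', ''F-regular'', ''strongly F-regular'', ''almost locally simple''.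
   Context: Rings are associative and unital; modules are unitary. A ring $T$ is (von Neumann) regular if for each $a\in T$ there is $y\in T$ with $a=aya$. $\mathrm{Ann}_R(M)=\{a\in R: Ma=0\}$. For an $R$-module $N$ and $a\in R$ put $l_N(a)=\{n\in N: na=0\}$. Definitions for an $R$-module $N$ over a commutative ring $R$: - $N$ is a multiplication module if for each submodule $K$ of $N$ there is an ideal $A$ of $R$ with $K=NA$. - $N$ is morphic if $N/\varphi(N)\cong\ker(\varphi)$ as $R$-modules for every $\varphi\in\mathrm{End}_R(N)$. - $N$ is weakly-morphic if $N/Na\cong l_N(a)$ as $R$-modules for each $a\in R$. - $N$ is reduced if whenever $a\in R$, $n\in N$ satisfy $na^2=0$, then $nRa=0$. - $N$ is co-reduced if $Na=Na^k$ for every $a\in R$ and every positive integer $k$. - $N$ is endoregular if $\varphi(N)$ and $\ker(\varphi)$ are direct summands of $N$ for every $\varphi\in\mathrm{End}_R(N)$. - $N$ is weakly-endoregular if $Na$ and $l_N(a)$ are direct summands of $N$ for each $a\in R$. - $N$ is Abelian endoregular if $T=\mathrm{End}_R(N)$ is a strongly regular ring, i.e. for each $t\in T$ there is $y\in T$ with $t=t^2y$. - $N$ is JT-regular if for each $n\in N$ there is $a\in R$ with $nR=Na=Na^2$. - $N$ is weakly JT-regular if $Na=Na^2$ for each $a\in R$. - $N$ is almost locally simple if for each maximal ideal $\mathcal{M}$ of $R$ the localization $N_{\mathcal{M}}$ is a zero or simple $R_{\mathcal{M}}$-module. - $N$ is F-regular if for every submodule $K$ of $N$ the sequence $0\to K\otimes_R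 E\to N\otimes_R E$ is exact for each $R$-module $E$. - $N$ is strongly F-regular if every finitely generated submodule of $N$ is a direct summand of $N$. *)

(* Defs.v *)
From HB Require Import structures.
From mathcomp Require Import all_boot all_algebra.
From mathcomp Require Import generic_quotient ring_quotient.
From mathcomp Require Import boolp ring.
From mathcomp.multinomials Require Import freeg.

Set Implicit Arguments.
Unset Strict Implicit.
Unset Printing Implicit Defensive.

Import GRing.Theory.
Local Open Scope ring_scope.
Local Open Scope quotient_scope.

(* Over a commutative ring, right modules are left modules: the product n a
   is written [a *: n].  A submodule of [N] is a [submodClosed N], and an ideal,
   possibly improper, is a submodule of the regular module [R^o]; [idealr R]
   is the type of proper ideals.  Membership predicates are boolean; [`[< _ >]]
   turns any proposition into one, so every submodule arises in this way. *)

Section SubmoduleType.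
Variables (R : comNzRingType) (N : lmodType R) (K : submodClosed N).

Record submod := Submod { submod_val : N; submod_valP : submod_val \in K }.

HB.instance Definition _ := [isSub for submod_val].
HB.instance Definition _ := [Choice of submod by <:].
HB.instance Definition _ := [SubChoice_isSubLmodule of submod by <:].

Definition submod_incl : {linear submod -> N} := val.
End SubmoduleType.

Section QuotientModule.
Variables (R : comNzRingType) (N : lmodType R) (K : submodClosed N).

Definition zmodClosed_of_submod : zmodClosed N :=
  HB.pack_for (zmodClosed N) (GRing.SubmodClosed.sort K)
    (GRing.isZmodClosed.Build N (GRing.SubmodClosed.sort K)
       (GRing.submod_closedB (GRing.submodClosedP K))).

(* N / K *)
Definition quotmod : Type := Quotient.quot zmodClosed_of_submod.
HB.instance Definition _ := GRing.Zmodule.on quotmod.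
HB.instance Definition _ := Quotient.on quotmod.

Definition quotmod_scale (a : R) : quotmod -> quotmod :=
  lift_op1 quotmod ( *:%R a).

Lemma quotmod_piD : {morph \pi_quotmod : x y / x + y}.
Proof. by move=> x y; rewrite piE. Qed.

Lemma quotmod_eq (x y : N) :
  reflect (\pi_quotmod x = \pi_quotmod y) (x - y \in K).
Proof.
apply: (iffP idP) => [xy|/eqP]; last by rewrite -Quotient.idealrBE.
by apply/eqP; rewrite -Quotient.idealrBE.
Qed.

Lemma pi_quotmod_scale a (n : N) :
  \pi_quotmod (a *: n) = quotmod_scale a (\pi_quotmod n).
Proof.
unlock quotmod_scale; apply/quotmod_eq; rewrite -scalerBr.
by rewrite rpredZ //; apply/quotmod_eq; rewrite reprK.
Qed.

Lemma quotmod_scaleA a b x :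
  quotmod_scale a (quotmod_scale b x) = quotmod_scale (a * b) x.
Proof. by elim/quotW: x => n; rewrite -!pi_quotmod_scale scalerA. Qed.

Lemma quotmod_scale1 : left_id 1 quotmod_scale.
Proof. by elim/quotW => n; rewrite -pi_quotmod_scale scale1r. Qed.

Lemma quotmod_scaleDr : right_distributive quotmod_scale +%R.
Proof.
move=> a; elim/quotW => n; elim/quotW => m.
by rewrite -quotmod_piD -!pi_quotmod_scale -quotmod_piD scalerDr.
Qed.

Lemma quotmod_scaleDl x : {morph quotmod_scale^~ x : a b / a + b}.
Proof.
by elim/quotW: x => n a b; rewrite -!pi_quotmod_scale -quotmod_piD scalerDl.
Qed.

HB.instance Definition _ := GRing.Zmodule_isLmodule.Build R quotmod
  quotmod_scaleA quotmod_scale1 quotmod_scaleDr quotmod_scaleDl.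

Definition quotmod_pi : N -> quotmod := \pi_quotmod.

Lemma quotmod_pi_is_linear : linear quotmod_pi.
Proof. by move=> a x y; rewrite /quotmod_pi quotmod_piD pi_quotmod_scale. Qed.
HB.instance Definition _ :=
  GRing.isLinear.Build R N quotmod *:%R quotmod_pi quotmod_pi_is_linear.

Lemma quotmod_pi_eq0 n : (quotmod_pi n == 0) = (n \in K).
Proof.
rewrite -(linear0 quotmod_pi); apply/eqP/idP => [/quotmod_eq|nK];
  first by rewrite subr0.
by apply/quotmod_eq; rewrite subr0.
Qed.

Lemma quotmodW (P : quotmod -> Prop) :
  (forall n, P (quotmod_pi n)) -> forall x, P x.
Proof. by move=> h; elim/quotW. Qed.
End QuotientModule.

Section Submodules.
Variables (R : comNzRingType) (N : lmodType R).

(* N a *)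
Definition mulsub (a : R) : {pred N} := [pred n | `[< exists m, n = a *: m >]].

Lemma mulsub_submod a : submod_closed (mulsub a).
Proof.
split=> [|c x y /asboolP[x' ->] /asboolP[y' ->]]; apply/asboolP.
  by exists 0; rewrite scaler0.
by exists (c *: x' + y'); rewrite scalerDr !scalerA mulrC.
Qed.
HB.instance Definition _ a := GRing.isSubmodClosed.Build R N (mulsub a)
  (mulsub_submod a).

(* l_N(a) *)
Definition annsub (a : R) : {pred N} := [pred n | a *: n == 0].

Lemma annsub_submod a : submod_closed (annsub a).
Proof.
split=> [|c x y /eqP xa /eqP ya]; rewrite !inE ?scaler0 //.
by rewrite scalerDr scalerA mulrC -scalerA xa ya scaler0 addr0.
Qed.
HB.instance Definition _ a := GRing.isSubmodClosed.Build R N (annsub a)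
  (annsub_submod a).

(* n R *)
Definition cycsub (n : N) : {pred N} := [pred x | `[< exists r, x = r *: n >]].

Lemma cycsub_submod n : submod_closed (cycsub n).
Proof.
split=> [|c x y /asboolP[r ->] /asboolP[s ->]]; apply/asboolP.
  by exists 0; rewrite scale0r.
by exists (c * r + s); rewrite scalerDl scalerA.
Qed.
HB.instance Definition _ n := GRing.isSubmodClosed.Build R N (cycsub n)
  (cycsub_submod n).

Definition gensub (P : N -> Prop) : {pred N} :=
  [pred x | `[< forall K : submodClosed N,
    (forall y, P y -> y \in K) -> x \in K >]].

Lemma gensub_submod P : submod_closed (gensub P).
Proof.
split=> [|c x y /asboolP xP /asboolP yP]; apply/asboolP => K KP.
  exact: rpred0.
by rewrite rpredD ?rpredZ ?xP ?yP.
Qed.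
HB.instance Definition _ P := GRing.isSubmodClosed.Build R N (gensub P)
  (gensub_submod P).

(* x \in N A *)
Definition in_idealmul (A : submodClosed R^o) (x : N) : Prop :=
  exists2 s : seq (R^o * N),
    {in s, forall p, p.1 \in A} & x = \sum_(p <- s) p.1 *: p.2.

Definition direct_summand (K : submodClosed N) : Prop :=
  exists L : submodClosed N,
    (forall x, x \in K -> x \in L -> x = 0) /\
    (forall x, exists k l, [/\ k \in K, l \in L & x = k + l]).

Definition nonzero_module : Prop := exists n : N, n != 0.
End Submodules.

Arguments mulsub {R} N a.
Arguments annsub {R} N a.

Section LinearSubmodules.
Variables (R : comNzRingType) (U V : lmodType R) (f : {linear U -> V}).

Definition imsub : {pred V} := [pred y | `[< exists x, y = f x >]].

Lemma imsub_submod : submod_closed imsub.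
Proof.
split=> [|c x y /asboolP[x' ->] /asboolP[y' ->]]; apply/asboolP.
  by exists 0; rewrite linear0.
by exists (c *: x' + y'); rewrite linearP.
Qed.
HB.instance Definition _ := GRing.isSubmodClosed.Build R V imsub imsub_submod.

Definition kersub : {pred U} := [pred x | f x == 0].

Lemma kersub_submod : submod_closed kersub.
Proof.
split=> [|c x y /eqP x0 /eqP y0]; rewrite !inE ?linear0 //.
by rewrite linearP x0 y0 scaler0 addr0.
Qed.
HB.instance Definition _ := GRing.isSubmodClosed.Build R U kersub kersub_submod.
End LinearSubmodules.

Definition isomorphic (R : comNzRingType) (U V : lmodType R) : Prop :=
  exists f : {linear U -> V}, bijective f.

Definition finitely_generated (R : comNzRingType) (N : lmodType R) : Prop :=
  exists s : seq N, forall x : N,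
    exists c : 'I_(size s) -> R, x = \sum_(i < size s) c i *: s`_i.

Definition regular_ring (T : pzRingType) : Prop :=
  forall a : T, exists y : T, a = a * y * a.

Section Annihilator.
Variables (R : comNzRingType) (N : lmodType R).

Definition ann : {pred R} := [pred a | `[< forall n : N, a *: n = 0 >]].

Lemma ann_idealr (N_neq0 : nonzero_module N) : idealr_closed ann.
Proof.
split; first by apply/asboolP => n; rewrite scale0r.
  by case: N_neq0 => n n0; apply/asboolP => /(_ n)/eqP; rewrite scale1r (negPf n0).
move=> a x y /asboolP xN /asboolP yN; apply/asboolP => n.
by rewrite scalerDl -scalerA xN yN scaler0 addr0.
Qed.

(* Ann_R(N), a proper ideal since N is nonzero *)
Definition Ann (N_neq0 : nonzero_module N) : idealr R :=
  HB.pack_for (idealr R) ann (isIdealr.Build R ann (ann_idealr N_neq0)).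
End Annihilator.

Section Localization.
Variables (R : comNzRingType) (S : mulrClosed R).

Definition denom : Type := {s : R | s \in S}.
HB.instance Definition _ := Choice.on denom.

Definition denom1 : denom := exist _ 1 (rpred1 S).
Definition denomM (s t : denom) : denom :=
  exist _ (sval s * sval t) (rpredM (svalP s) (svalP t)).

Section LocModule.
Variable N : lmodType R.

(* n/s = m/t iff u (t n) = u (s m) for some u in S *)
Definition loc_equiv (x y : N * denom) : bool :=
  `[< exists2 u, u \in S &
      u *: (sval y.2 *: x.1) = u *: (sval x.2 *: y.1) >].

Lemma loc_equiv_is_equiv : equiv_class_of loc_equiv.
Proof.
split.
- by move=> x; apply/asboolP; exists 1; rewrite ?rpred1.
- move=> x y; apply/asboolP/asboolP => -[u uS e];
  by exists u; rewrite // e.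
- move=> y x z /asboolP[u uS exy] /asboolP[v vS eyz]; apply/asboolP.
  exists (u * v * sval y.2); first by rewrite !rpredM ?(svalP y.2).
  move/(congr1 ( *:%R (v * sval z.2))): exy.
  move/(congr1 ( *:%R (u * sval x.2))): eyz.
  rewrite !scalerA => eyz exy.
  have -> : u * v * sval y.2 * sval z.2 = v * sval z.2 * u * sval y.2 by ring.
  have -> : u * v * sval y.2 * sval x.2 = u * sval x.2 * v * sval y.2 by ring.
  by rewrite -eyz exy; congr (_ *: _); ring.
Qed.

Canonical loc_equiv_equiv := EquivRelPack loc_equiv_is_equiv.
Canonical loc_equiv_encModRel := defaultEncModRel loc_equiv.

(* S^-1 N *)
Definition locmod : Type := {eq_quot loc_equiv}.
HB.instance Definition _ : EqQuotient _ loc_equiv locmod := EqQuotient.on locmod.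
HB.instance Definition _ := Choice.on locmod.

(* n / s *)
Definition locfrac (n : N) (s : denom) : locmod := \pi_locmod (n, s).

Lemma locfrac_eqP n s m t :
  locfrac n s = locfrac m t <->
  exists2 u, u \in S & u *: (sval t *: n) = u *: (sval s *: m).
Proof. by split=> [/eqmodP/asboolP|h]; last apply/eqmodP/asboolP. Qed.

Lemma locfrac_repr (x : locmod) : x = locfrac (repr x).1 (repr x).2.
Proof. by rewrite -[LHS]reprK; case: (repr x). Qed.

Lemma locfracW (P : locmod -> Prop) :
  (forall n s, P (locfrac n s)) -> forall x, P x.
Proof. by move=> h x; rewrite [x]locfrac_repr. Qed.

Definition loc_zero : locmod := locfrac 0 denom1.
Definition loc_opp (x : locmod) : locmod := locfrac (- (repr x).1) (repr x).2.
Definition loc_add (x y : locmod) : locmod :=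
  locfrac (sval (repr y).2 *: (repr x).1 + sval (repr x).2 *: (repr y).1)
    (denomM (repr x).2 (repr y).2).

Lemma loc_oppE n s : loc_opp (locfrac n s) = locfrac (- n) s.
Proof.
rewrite /loc_opp; have /locfrac_eqP[u uS e] := locfrac_repr (locfrac n s).
by apply/locfrac_eqP; exists u; rewrite // !scalerN e.
Qed.

Lemma loc_addE n s m t :
  loc_add (locfrac n s) (locfrac m t) =
  locfrac (sval t *: n + sval s *: m) (denomM s t).
Proof.
rewrite /loc_add.
have /locfrac_eqP[u uS] := locfrac_repr (locfrac n s).
have /locfrac_eqP[v vS] := locfrac_repr (locfrac m t).
case: (repr (locfrac n s)) => n' s'; case: (repr (locfrac m t)) => m' t' /= ev eu.
apply/locfrac_eqP; exists (u * v); rewrite ?rpredM //= !scalerDr.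
move/(congr1 ( *:%R (v * sval t * sval t'))): eu.
move/(congr1 ( *:%R (u * sval s * sval s'))): ev.
rewrite !scalerA => ev eu; congr (_ + _).
- by transitivity ((v * sval t * sval t' * u * sval s) *: n');
    [congr (_ *: _) | rewrite -eu; congr (_ *: _)]; ring.
- by transitivity ((u * sval s * sval s' * v * sval t) *: m');
    [congr (_ *: _) | rewrite -ev; congr (_ *: _)]; ring.
Qed.

Lemma locfrac_eq n s m t :
  sval t *: n = sval s *: m -> locfrac n s = locfrac m t.
Proof. by move=> e; apply/locfrac_eqP; exists 1; rewrite ?rpred1 // e. Qed.

Lemma loc_addA : associative loc_add.
Proof.
elim/locfracW=> n s; elim/locfracW=> m t; elim/locfracW=> p w.
rewrite !loc_addE; apply: locfrac_eq; rewrite /= !scalerDr !scalerA.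
by rewrite addrA; congr (_ *: _ + _ *: _ + _ *: _); ring.
Qed.

Lemma loc_addC : commutative loc_add.
Proof.
elim/locfracW=> n s; elim/locfracW=> m t; rewrite !loc_addE.
by apply: locfrac_eq; rewrite /= addrC mulrC.
Qed.

Lemma loc_add0 : left_id loc_zero loc_add.
Proof.
elim/locfracW=> n s; rewrite loc_addE; apply: locfrac_eq.
by rewrite /= scaler0 add0r scale1r mul1r.
Qed.

Lemma loc_addN : left_inverse loc_zero loc_opp loc_add.
Proof.
elim/locfracW=> n s; rewrite loc_oppE loc_addE; apply: locfrac_eq.
by rewrite /= scalerN addNr !scaler0.
Qed.

HB.instance Definition _ := GRing.isZmodule.Build locmod
  loc_addA loc_addC loc_add0 loc_addN.

Lemma locfracD n s m t :
  locfrac n s + locfrac m t = locfrac (sval t *: n + sval s *: m) (denomM s t).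
Proof. exact: loc_addE. Qed.
End LocModule.

(* (a/s) (n/t) = (a n)/(s t) *)
Definition loc_scale (N : lmodType R) (c : locmod R^o) (x : locmod N) : locmod N :=
  locfrac (((repr c).1 : R) *: (repr x).1) (denomM (repr c).2 (repr x).2).

Lemma loc_scaleE (N : lmodType R) (a : R) s (n : N) t :
  loc_scale (locfrac (a : R^o) s) (locfrac n t) = locfrac (a *: n) (denomM s t).
Proof.
rewrite /loc_scale.
have /locfrac_eqP[u uS] := locfrac_repr (locfrac (a : R^o) s).
have /locfrac_eqP[v vS] := locfrac_repr (locfrac n t).
case: (repr (locfrac (a : R^o) s)) => a' s'.
case: (repr (locfrac n t)) => n' t' /= ev eu.
apply/locfrac_eqP; exists (u * v); rewrite ?rpredM //=.
move/(congr1 ( *:%R (u * sval s' * a))): ev; rewrite !scalerA => ev.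
have {}eu : u * (sval s' * a) = u * (sval s * a') := eu.
transitivity ((u * (sval s * a') * v * sval t) *: n').
  by congr (_ *: _); ring.
rewrite -eu; transitivity ((u * sval s' * a * v * sval t) *: n').
  by congr (_ *: _); ring.
by rewrite -ev; congr (_ *: _); ring.
Qed.

Let regular_scale (a : R) (b : R^o) : a *: b = (a * b : R) :> R^o.
Proof. by []. Qed.

(* S^-1 R *)
Definition locring : Type := locmod R^o.
HB.instance Definition _ := GRing.Zmodule.on locring.

Definition locring_one : locring := locfrac (1 : R^o) denom1.

Lemma loc_scaleA (N : lmodType R) (c d : locring) (x : locmod N) :
  loc_scale c (loc_scale d x) = loc_scale (loc_scale c d) x.
Proof.
elim/locfracW: c => a s; elim/locfracW: d => b t; elim/locfracW: x => n w.
rewrite (loc_scaleE b t n w) (loc_scaleE a s b t) !loc_scaleE; apply: locfrac_eq; rewrite /= !regular_scale !scalerA.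
by congr (_ *: _); ring.
Qed.

Lemma loc_scale1 (N : lmodType R) : left_id locring_one (@loc_scale N).
Proof.
elim/locfracW=> n s; rewrite loc_scaleE; apply: locfrac_eq.
by rewrite /= scale1r mul1r.
Qed.

Lemma loc_scaleDr (N : lmodType R) : right_distributive (@loc_scale N) +%R.
Proof.
elim/locfracW=> a s; elim/locfracW=> n t; elim/locfracW=> m w.
rewrite (locfracD n t m w) (loc_scaleE a s n t) (loc_scaleE a s m w).
rewrite loc_scaleE locfracD; apply: locfrac_eq.
by rewrite /= !scalerDr !scalerA; congr (_ *: _ + _ *: _); ring.
Qed.

Lemma loc_scaleDl (N : lmodType R) (x : locmod N) (c d : locring) :
  loc_scale (c + d) x = loc_scale c x + loc_scale d x.
Proof.
elim/locfracW: c => a s; elim/locfracW: d => b t; elim/locfracW: x => n w.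
rewrite (locfracD a s b t) (loc_scaleE a s n w) (loc_scaleE b t n w).
rewrite loc_scaleE locfracD; apply: locfrac_eq.
rewrite /= !regular_scale.
rewrite !scalerDr !scalerA -scalerDl.
by congr (_ *: _); ring.
Qed.

Lemma locring_mulC : commutative (@loc_scale R^o : locring -> locring -> locring).
Proof.
elim/locfracW=> a s; elim/locfracW=> b t.
rewrite (loc_scaleE a s b t) (loc_scaleE b t a s).
apply: locfrac_eq; rewrite /= !regular_scale.
by congr (_ * _); apply: mulrC.
Qed.

Lemma locring_mulDl :
  left_distributive (@loc_scale R^o : locring -> locring -> locring) +%R.
Proof. by move=> c d x; apply: loc_scaleDl. Qed.

HB.instance Definition _ := GRing.Zmodule_isComPzRing.Build locring
  (@loc_scaleA R^o) locring_mulC (@loc_scale1 R^o) locring_mulDl.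

HB.instance Definition _ (N : lmodType R) :=
  GRing.Zmodule_isLmodule.Build locring (locmod N)
    (@loc_scaleA N) (@loc_scale1 N) (@loc_scaleDr N)
    (fun x : locmod N => @loc_scaleDl N x).
End Localization.

Section MaximalIdeals.
Variables (R : comNzRingType) (m : idealr R).

Definition maximal_ideal : Prop :=
  forall J : idealr R, {subset m <= J} -> {subset J <= m}.

Definition ideal_compl : {pred R} := [pred s | s \notin m].

Lemma ideal_compl_mulr_closed : maximal_ideal -> mulr_closed ideal_compl.
Proof.
move=> max_m; split=> [|s t sm tm]; first by rewrite inE idealr1.
apply/negP => stm; move/negP: (tm); apply.
pose J : {pred R} := [pred x | `[< exists r, x - r * s \in m >]].
have mJ x : x \in m -> x \in J.
  by move=> xm; apply/asboolP; exists 0; rewrite mul0r subr0.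
have [/asboolP[r rs]|J1] := boolP (1 \in J).
  rewrite -[t]mul1r -[1](subrK (r * s)) mulrDl rpredD //.
    by rewrite mulrC idealMr.
  by rewrite -mulrA idealMr.
have Jideal : idealr_closed J.
  split=> [|//|a x y /asboolP[r xr] /asboolP[q yq]]; first by rewrite mJ ?rpred0.
  apply/asboolP; exists (a * r + q).
  have -> : a * x + y - (a * r + q) * s = a * (x - r * s) + (y - q * s) by ring.
  by rewrite rpredD // idealMr.
pose J' := HB.pack_for (idealr R) J (isIdealr.Build R J Jideal).
case/negP: sm; apply: (max_m J'); first exact: mJ.
by apply/asboolP; exists 1; rewrite mul1r subrr rpred0.
Qed.

Definition compl_mulrClosed (max_m : maximal_ideal) : mulrClosed R :=
  HB.pack_for (mulrClosed R) ideal_compl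
    (GRing.isMulClosed.Build R ideal_compl (ideal_compl_mulr_closed max_m)).
End MaximalIdeals.

Section FreeModuleLift.
Variables (R : comNzRingType) (T : choiceType) (W : lmodType R) (f : T -> W).

Lemma fglift_is_linear : linear (fglift f : {freeg T / R} -> W).
Proof.
have D x y : fglift f (x + y) = fglift f x + fglift f y.
  have := lift_is_additive f (x + y) y; rewrite addrK => ->.
  by rewrite subrK.
have fs (I : Type) (r : seq I) (F : I -> {freeg T / R}) :
    fglift f (\sum_(i <- r) F i) = \sum_(i <- r) fglift f (F i).
  elim: r => [|i r IH]; last by rewrite !big_cons D IH.
  by rewrite !big_nil; apply: (addrI (fglift f 0)); rewrite -D !addr0.
move=> a x y; rewrite D; congr (_ + _).
rewrite -{2}[x]freeg_sumE fs scaler_sumr [a *: x]/(fgscale a x) /fgscale fs.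
by apply: eq_bigr => t _; rewrite !liftU scalerA.
Qed.

HB.instance Definition _ :=
  GRing.isLinear.Build R {freeg T / R} W *:%R (fglift f) fglift_is_linear.
End FreeModuleLift.

Section TensorProduct.
Variables (R : comNzRingType) (U V : lmodType R).
Local Notation F := {freeg (U * V) / R}.
Local Notation gen u v := (<< (u, v) >> : F).

Variant tensor_rel : F -> Prop :=
  | TensorDl u1 u2 v : tensor_rel (gen (u1 + u2) v - gen u1 v - gen u2 v)
  | TensorDr u v1 v2 : tensor_rel (gen u (v1 + v2) - gen u v1 - gen u v2)
  | TensorZl a u v : tensor_rel (gen (a *: u) v - a *: gen u v)
  | TensorZr a u v : tensor_rel (gen u (a *: v) - a *: gen u v).

(* U \otimes_R V *)
Definition tensor : lmodType R := quotmod (gensub tensor_rel).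

(* u \otimes v *)
Definition pure_tensor (u : U) (v : V) : tensor := quotmod_pi _ (gen u v).

Lemma tensor_rel_pi (x : F) :
  tensor_rel x -> quotmod_pi (gensub tensor_rel) x = 0.
Proof.
by move=> xP; apply/eqP; rewrite quotmod_pi_eq0; apply/asboolP => K; apply.
Qed.

Lemma pure_tensor_linearl v : linear (pure_tensor^~ v).
Proof.
move=> a u1 u2; rewrite /pure_tensor.
have /eqP := tensor_rel_pi (TensorDl (a *: u1) u2 v).
have /eqP := tensor_rel_pi (TensorZl a u1 v).
rewrite !linearB linearZ /= subr_eq0 => /eqP -> /[!subr_eq0].
by rewrite subr_eq addrC => /eqP.
Qed.

Lemma pure_tensor_linearr u : linear (pure_tensor u).
Proof.
move=> a v1 v2; rewrite /pure_tensor.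
have /eqP := tensor_rel_pi (TensorDr u (a *: v1) v2).
have /eqP := tensor_rel_pi (TensorZr a u v1).
rewrite !linearB linearZ /= subr_eq0 => /eqP -> /[!subr_eq0].
by rewrite subr_eq addrC => /eqP.
Qed.

Section Lift.
Variables (W : lmodType R) (b : U -> V -> W).

Definition tensor_lift (t : tensor) : W :=
  fglift (fun p : U * V => b p.1 p.2) (repr (t : quotmod (gensub tensor_rel))).

Hypothesis b_linearl : forall v, linear (b^~ v).
Hypothesis b_linearr : forall u, linear (b u).

Lemma tensor_lift_pi (x : F) :
  tensor_lift (quotmod_pi _ x) = fglift (fun p : U * V => b p.1 p.2) x.
Proof.
pose g : {linear F -> W} := fglift (fun p : U * V => b p.1 p.2).
pose bl v : {linear U -> W} :=
  HB.pack_for {linear U -> W} (b^~ v)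
    (GRing.isLinear.Build R U W *:%R (b^~ v) (b_linearl v)).
pose br u : {linear V -> W} :=
  HB.pack_for {linear V -> W} (b u)
    (GRing.isLinear.Build R V W *:%R (b u) (b_linearr u)).
have bDl u1 u2 v : b (u1 + u2) v = b u1 v + b u2 v := linearD (bl v) u1 u2.
have bDr u v1 v2 : b u (v1 + v2) = b u v1 + b u v2 := linearD (br u) v1 v2.
have bZl a u v : b (a *: u) v = a *: b u v := linearZ_LR (bl v) a u.
have bZr a u v : b u (a *: v) = a *: b u v := linearZ_LR (br u) a v.
have gE u v : g (gen u v) = b u v by rewrite /g /= liftU scale1r.
have /asboolP /(_ (kersub g)) h :
    repr (quotmod_pi (gensub tensor_rel) x) - x \in gensub tensor_rel.
  by apply/quotmod_eq; rewrite reprK.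
suff: g (repr (quotmod_pi (gensub tensor_rel) x) - x) == 0.
  by rewrite linearB subr_eq0 => /eqP.
apply: h => y [] *; rewrite inE !linearB ?linearZ /= ?gE.
- by rewrite bDl addrAC addrK subrr.
- by rewrite bDr addrAC addrK subrr.
- by rewrite bZl scalerN subrr.
- by rewrite bZr scalerN subrr.
Qed.

Lemma tensor_liftE u v : tensor_lift (pure_tensor u v) = b u v.
Proof. by rewrite tensor_lift_pi liftU scale1r. Qed.

Lemma tensor_lift_is_linear : linear tensor_lift.
Proof.
move=> a; elim/quotmodW => x; elim/quotmodW => y.
by rewrite -linearP !tensor_lift_pi linearP.
Qed.
End Lift.
End TensorProduct.

(* f \otimes id : U \otimes E -> V \otimes E *)
Section TensorMap.
Variables (R : comNzRingType) (U V : lmodType R) (f : {linear U -> V}).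
Variable E : lmodType R.

Definition tensor_map : tensor U E -> tensor V E :=
  tensor_lift (fun (u : U) (e : E) => pure_tensor (f u) e).

Let tensor_map_linl (e : E) : linear (fun u => pure_tensor (f u) e).
Proof. by move=> a u1 u2; rewrite linearP pure_tensor_linearl. Qed.

Lemma tensor_mapE u e : tensor_map (pure_tensor u e) = pure_tensor (f u) e.
Proof.
by apply: tensor_liftE => // u'; apply: pure_tensor_linearr.
Qed.

Lemma tensor_map_is_linear : linear tensor_map.
Proof. by apply: tensor_lift_is_linear => // u; apply: pure_tensor_linearr. Qed.

HB.instance Definition _ := GRing.isLinear.Build R (tensor U E) (tensor V E)
  *:%R tensor_map tensor_map_is_linear.
End TensorMap.

Arguments tensor_map {R U V} f E.

Section ModuleProperties.
Variables (R : comNzRingType) (N : lmodType R).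

Definition multiplication_module : Prop :=
  forall K : submodClosed N, exists A : submodClosed R^o,
    forall x, x \in K <-> in_idealmul A x.

Definition morphic : Prop :=
  forall f : {linear N -> N}, isomorphic (quotmod (imsub f)) (submod (kersub f)).

Definition weakly_morphic : Prop :=
  forall a : R, isomorphic (quotmod (mulsub N a)) (submod (annsub N a)).

Definition reduced_module : Prop :=
  forall (a : R) (n : N), (a ^+ 2) *: n = 0 -> forall r : R, (r * a) *: n = 0.

Definition co_reduced : Prop :=
  forall (a : R) (k : nat), (0 < k)%N -> mulsub N a =i mulsub N (a ^+ k).

Definition endoregular : Prop :=
  forall f : {linear N -> N},
    direct_summand (imsub f) /\ direct_summand (kersub f).

Definition weakly_endoregular : Prop :=
  forall a : R, direct_summand (mulsub N a) /\ direct_summand (annsub N a).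

(* The product of the endomorphism ring is composition. *)
Definition abelian_endoregular : Prop :=
  forall t : {linear N -> N}, exists y : {linear N -> N}, t =1 t \o t \o y.

Definition JT_regular : Prop :=
  forall n : N, exists a : R,
    cycsub n =i mulsub N a /\ mulsub N a =i mulsub N (a ^+ 2).

Definition weakly_JT_regular : Prop :=
  forall a : R, mulsub N a =i mulsub N (a ^+ 2).

Definition F_regular : Prop :=
  forall (K : submodClosed N) (E : lmodType R),
    injective (tensor_map (submod_incl K) E).

Definition strongly_F_regular : Prop :=
  forall K : submodClosed N, finitely_generated (submod K) -> direct_summand K.
End ModuleProperties.

Definition zero_module (A : pzRingType) (V : lmodType A) : Prop :=
  forall v : V, v = 0.

Definition simple_module (A : pzRingType) (V : lmodType A) : Prop :=
  ~ zero_module V /\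
  forall K : submodClosed V, (forall v, v \in K -> v = 0) \/ (forall v, v \in K).

Definition almost_locally_simple (R : comNzRingType) (N : lmodType R) : Prop :=
  forall (m : idealr R) (max_m : maximal_ideal m),
    let N_m : lmodType (locring (compl_mulrClosed max_m)) :=
      locmod (compl_mulrClosed max_m) N in
    zero_module N_m \/ simple_module N_m.

Definition every_cyclic_submodule (R : comNzRingType) (N : lmodType R)
    (P : lmodType R -> Prop) : Prop :=
  forall n : N, P (submod (cycsub n)).

(* Main.v *)
Require Import Defs.
From HB Require Import structures.
From mathcomp Require Import all_boot all_algebra.
From mathcomp Require Import ring_quotient.
From mathcomp Require Import generic_quotient boolp classical_sets ring.
From mathcomp.multinomials Require Import freeg.

Set Implicit Arguments.
Unset Strict Implicit.
Unset Printing Implicit Defensive.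

Import GRing.Theory.
Local Open Scope ring_scope.

(** Every listed property is equivalent to one elementwise condition,
[ann_regular M]: for each [a] some [y] satisfies [a n = a y a n] for all [n],
which is regularity of [R / Ann(M)] without the quotient ring.  The equivalence
is shown for all finitely generated multiplication modules [N] at once.  A
cyclic module is of this kind, and [M] is [ann_regular] as soon as its cyclic
submodules are ([fg_pointwise_regular]), so the conditions on cyclic submodules
follow from the same equivalences, applied to each of them.

From a property to [ann_regular N].  Nearly always the property gives [N a = N
a^2] for each [a]: a complement [L] of [N a] satisfies [L a <= L :&: N a = 0];
under reducedness [a] kills [l_N(a^2)], hence [N / N a^2]; F-regularity is
tested on [N a] and the module [R / R a]; local simplicity is tested at a
maximal ideal containing [{r | r a n \in N a^2}]. Since [N a] is finitely
generated, [N a = (N a) a] yields, by the determinant trick, an element of [R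
a] acting as the identity on [N a] ([square_stable_regular]).

From [ann_regular N] to a property.  Each product [a n] is fixed by [a y], a
scalar in the ideal [R a].  Two such local units [d], [e] merge into [e + (1 -
e) d], so finitely many can be replaced by one ([common_unit]).  As [N] is a
multiplication module, every finite subset of a submodule [K] is then fixed by
some [e] with [N e <= K] ([local_units]). Multiplication by this [e] retracts
[N] onto the part of [K] at hand, whence strong F-regularity, F-regularity,
JT-regularity and local simplicity.  Local units also make [N] cyclic
([local_units_cyclic]); every endomorphism is then multiplication by some [a],
and [a y] splits [N] as [N a] plus [l_N(a)], which settles the properties about
endomorphisms. *)

(** * Linear maps and ideals attached to submodules *)

Section Corestriction.
Variables (R : comNzRingType) (U V : lmodType R) (K : submodClosed V).
Variables (f : {linear U -> V}) (fK : forall u, f u \in K).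

Definition corestrict (u : U) : submod K := Submod (fK u).

Lemma corestrict_is_linear : linear corestrict.
Proof. by move=> a u v; apply: val_inj; rewrite /= linearP. Qed.

HB.instance Definition _ :=
  GRing.isLinear.Build R U (submod K) *:%R corestrict corestrict_is_linear.
End Corestriction.

Section QuotientLift.
Variables (R : comNzRingType) (U V : lmodType R) (K : submodClosed U).
Variable f : {linear U -> V}.

Definition quot_lift (_ : forall u, u \in K -> f u = 0) (x : quotmod K) : V :=
  f (repr x).

Hypothesis fK : forall u, u \in K -> f u = 0.

Lemma quot_liftE u : quot_lift fK (quotmod_pi K u) = f u.
Proof.
apply/eqP; rewrite -subr_eq0 -linearB; apply/eqP/fK.
by apply/quotmod_eq; rewrite reprK.
Qed.

Lemma quot_lift_is_linear : linear (quot_lift fK).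
Proof.
move=> a; elim/quotmodW=> u; elim/quotmodW=> v.
by rewrite -linearP !quot_liftE linearP.
Qed.

HB.instance Definition _ :=
  GRing.isLinear.Build R (quotmod K) V *:%R (quot_lift fK) quot_lift_is_linear.
End QuotientLift.

Section ScaleAt.
Variables (R : comNzRingType) (V : lmodType R) (v : V).

Definition scale_at (r : R^o) : V := (r : R) *: v.

Lemma scale_at_is_linear : linear scale_at.
Proof. by move=> a r s; rewrite /scale_at scalerDl scalerA. Qed.

HB.instance Definition _ :=
  GRing.isLinear.Build R R^o V *:%R scale_at scale_at_is_linear.
End ScaleAt.

Section Conductor.
Variables (R : comNzRingType) (N : lmodType R) (K : submodClosed N).

Definition conductor : {pred R^o} :=
  [pred r : R^o | `[< forall n : N, (r : R) *: n \in K >]].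

Lemma conductorP (r : R) :
  reflect (forall n : N, r *: n \in K) (r \in conductor).
Proof. by apply: (iffP idP) => [/asboolP|rK]; last apply/asboolP. Qed.

Lemma conductor_submod : submod_closed conductor.
Proof.
split=> [|a r s /conductorP rK /conductorP sK]; apply/conductorP => n;
  rewrite -[_ *: n]/(scale_at n _); first by rewrite linear0 rpred0.
by rewrite linearP rpredD //; [apply/rpredZ/rK | apply: sK].
Qed.

HB.instance Definition _ :=
  GRing.isSubmodClosed.Build R R^o conductor conductor_submod.
End Conductor.

Section Transporter.
Variables (R : comNzRingType) (N : lmodType R) (K : submodClosed N) (n : N).

Definition transporter : {pred R^o} := [pred r | scale_at n r \in K].

Lemma transporter_submod : submod_closed transporter.
Proof.
split=> [|a r s]; rewrite !inE; first by rewrite linear0 rpred0.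
by move=> rK sK; rewrite linearP rpredD //; apply: rpredZ.
Qed.

HB.instance Definition _ :=
  GRing.isSubmodClosed.Build R R^o transporter transporter_submod.
End Transporter.

(** * Scalars fixing finitely many elements, and the determinant trick *)

Section Units.
Variable R : comNzRingType.
Implicit Types (N : lmodType R) (a e y : R).

(** If [e] and [d] fix [s] and [x], then [e + (1 - e) d] fixes both, since its
difference from 1 is [(1 - e) (1 - d)]. *)
Lemma common_unit N (A : submodClosed R^o) (s : seq N) :
    {in s, forall x, exists2 e : R, e \in A & e *: x = x} ->
  exists2 e : R, e \in A & {in s, forall x, e *: x = x}.
Proof.
elim: s => [|x s IHs] sA; first by exists 0 => //; exact: (rpred0 A).
have [e eA es] := IHs (fun z zs => sA z (@mem_behead _ (x :: s) z zs)).
have [d dA dx] := sA x (mem_head x s).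
exists (e + (1 - e) * d); first exact: rpredD eA (rpredZ (1 - e) dA).
move=> z /predU1P[->|zs]; rewrite scalerDl.
  by rewrite -scalerA dx -scalerDl addrC subrK scale1r.
by rewrite mulrC -scalerA scalerBl scale1r es // subrr scaler0 addr0.
Qed.

Lemma fg_ext N (s : seq N) (a b : R) :
    (forall x : N, exists c : 'I_(size s) -> R,
       x = \sum_(i < size s) c i *: s`_i) ->
    {in s, forall x, a *: x = b *: x} -> forall x : N, a *: x = b *: x.
Proof.
move=> sN ab x; have [c ->] := sN x; rewrite !scaler_sumr.
apply: eq_bigr => i _.
by rewrite !scalerA ![_ * c i]mulrC -!scalerA ab // mem_nth.
Qed.

(** The hypothesis reads [(1 - a C) m = 0], so [\det (1 - a C)] kills each [m i]
by the adjugate formula, and this determinant is 1 modulo [a]. *)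
Lemma determinant_trick N n (m : 'I_n -> N) (C : 'M[R]_n) a :
    (forall i, m i = a *: \sum_j C i j *: m j) ->
  exists y, forall i, m i = (y * a) *: m i.
Proof.
move=> mC.
(* The factor [a] of [1 - \det (1 - a C)] is found with an indeterminate in
   place of [a]: the polynomial [1 - p] vanishes at 0. *)
pose p := \det (1%:M - 'X *: map_mx polyC C).
pose B := 1%:M - a *: C.
have p_a b : p.[b] = \det (1%:M - b *: C).
  rewrite -[p.[b]]/(horner_eval b p) -det_map_mx; congr (\det _).
  apply/matrixP=> i j; rewrite !mxE rmorphB rmorphM rmorph_nat /=.
  by rewrite /horner_eval hornerX hornerC.
have /factor_theorem[q pq] : root (1 - p) 0.
  by rewrite /root !hornerE p_a scale0r subr0 det1 subrr.
have detB : 1 - \det B = q.[a] * a.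
  by rewrite -p_a -[1](hornerC 1 a) -hornerN -hornerD polyC1 pq !hornerE subr0.
exists q.[a] => k; rewrite -detB scalerBl scale1r -[LHS]subr0; congr (_ - _).
have Bm i : \sum_j B i j *: m j = 0.
  under eq_bigr do rewrite !mxE scalerBl -scalerA.
  rewrite sumrB -scaler_sumr -mC (bigD1 i) //= eqxx scale1r.
  rewrite big1 ?addr0 ?subrr //.
  by move=> j /negPf; rewrite eq_sym => ->; rewrite scale0r.
transitivity (\sum_i \adj B k i *: \sum_j B i j *: m j).
  by rewrite big1 // => i _; rewrite Bm scaler0.
under eq_bigr do rewrite scaler_sumr.
rewrite exchange_big (eq_bigr (fun j => (\adj B *m B) k j *: m j)) /=.
  rewrite mul_adj_mx (bigD1 k) //= mxE eqxx big1 ?addr0 // => j /negPf kj.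
  by rewrite mxE eq_sym kj scale0r.
by move=> j _; rewrite mxE scaler_suml; apply: eq_bigr => i _; rewrite scalerA.
Qed.
End Units.

(** * Modules whose ring of scalars acts as a regular ring *)

Section AnnRegular.
Variable R : comNzRingType.
Implicit Types (N : lmodType R) (a e y : R).

(** Regularity of [R / Ann(N)], in a form that makes sense for the zero module:
there the annihilator is not proper, and zero is a cyclic submodule. *)
Definition ann_regular N : Prop :=
  forall a, exists y, forall n : N, a *: n = (a * y * a) *: n.

Lemma ann_regular_quotient N (N_neq0 : nonzero_module N) :
  ann_regular N <-> regular_ring (Quotient.quot (Ann N_neq0)).
Proof.
have AnnE a b : (\pi_(Quotient.quot (Ann N_neq0)) a = \pi b)%qT <->
    forall n : N, a *: n = b *: n.
  rewrite (rwP eqP) -Quotient.idealrBE; split.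
    by move=> /asboolP ab n; apply/eqP; rewrite -subr_eq0 -scalerBl ab.
  by move=> ab; apply/asboolP => n; rewrite scalerBl ab subrr.
split=> H.
  elim/quotW => a; have [y /AnnE ay] := H a.
  by exists (\pi_(Quotient.quot (Ann N_neq0)) y)%qT; rewrite -!rmorphM.
move=> a; have [y] := H (\pi_(Quotient.quot (Ann N_neq0)) a)%qT.
by elim/quotW: y => y; rewrite -!rmorphM => /AnnE; exists y.
Qed.

Definition pointwise_regular N : Prop :=
  forall a (n : N), exists y, a *: n = (a * y * a) *: n.

(** The witness [y] depends on [n]; on the multiples [a x] of the generators [x]
the products [a y] are local units in the ideal [R a], and a common one gives a
uniform witness. *)
Lemma fg_pointwise_regular N :
  finitely_generated N -> pointwise_regular N -> ann_regular N.
Proof.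
move=> [s sN] H a.
have [|e /asboolP[y ->] ye] :=
    @common_unit _ N (mulsub R^o a) [seq a *: x | x <- s].
  move=> _ /mapP[x _ ->]; have [y xE] := H a x.
  exists (a * y); first by apply/asboolP; exists y.
  by rewrite scalerA -xE.
exists y; apply: (fg_ext sN) => x xs.
by rewrite -[RHS]scalerA ye // map_f.
Qed.

Lemma weakly_JTP N :
  weakly_JT_regular N <-> forall a (n : N), exists m, a *: n = a ^+ 2 *: m.
Proof.
split=> H a n.
  apply/asboolP; rewrite -[`[< _ >]]/(_ \in mulsub N _) -H.
  by apply/asboolP; exists n.
apply/asboolP/asboolP => -[m ->]; first exact: H.
by exists (a *: m); rewrite scalerA.
Qed.

(** [N a] is finitely generated and equal to [(N a) a]. *)
Lemma square_stable_regular N a :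
    finitely_generated N -> (forall n : N, exists m, a *: n = a ^+ 2 *: m) ->
  exists y, forall n : N, a *: n = (a * y * a) *: n.
Proof.
move=> [s sN] a2.
have /choice[C mC] (i : 'I_(size s)) : exists c : 'I_(size s) -> R,
    a *: s`_i = a *: \sum_j c j *: (a *: s`_j).
  have [x ->] := a2 s`_i; have [c ->] := sN x; exists c.
  rewrite !scaler_sumr; apply: eq_bigr => j _; rewrite !scalerA.
  by congr (_ *: _); ring.
have [|y ay] := @determinant_trick _ _ _ (fun i => a *: s`_i)
    (\matrix_(i, j) C i j) a.
  by move=> i; rewrite [LHS]mC; under [in RHS]eq_bigr do rewrite mxE.
exists y; apply: (fg_ext sN) => _ /(nthP 0)[i si <-].
by rewrite (ay (Ordinal si)) scalerA; congr (_ *: _); ring.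
Qed.

Lemma weakly_JT_ann_regular N :
  finitely_generated N -> weakly_JT_regular N -> ann_regular N.
Proof.
by move=> N_fg /weakly_JTP H a; apply: square_stable_regular N_fg (H a).
Qed.
End AnnRegular.

(** * Each property makes the scalars act regularly *)

Section ToAnnRegular.
Variable R : comNzRingType.
Implicit Types (N : lmodType R) (a e y : R).

Lemma mulsubP N a (x : N) : reflect (exists m, x = a *: m) (x \in mulsub N a).
Proof. by apply: (iffP idP) => [/asboolP|?]; last apply/asboolP. Qed.

Lemma cycsubP N (n x : N) : reflect (exists r, x = r *: n) (x \in cycsub n).
Proof. by apply: (iffP idP) => [/asboolP|?]; last apply/asboolP. Qed.

Lemma cycsub_gen N (n : N) : n \in cycsub n.
Proof. by apply/cycsubP; exists 1; rewrite scale1r. Qed.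

Lemma submodB N (K : submodClosed N) (x y : N) :
  x \in K -> y \in K -> x - y \in K.
Proof. by move=> xK yK; rewrite -scaleN1r rpredD // rpredZ. Qed.

(** A scalar that kills [L] kills the isomorphic [N / K].  For a reduced module
this is used with the image and the kernel of [a ^+ 2]: [a] kills the latter. *)
Lemma iso_kills_quotient N (K L : submodClosed N) a :
    isomorphic (quotmod K) (submod L) ->
    (forall x, x \in L -> a *: x = 0) ->
  forall n : N, a *: n \in K.
Proof.
move=> [f /bij_inj f_inj] aL n; rewrite -quotmod_pi_eq0; apply/eqP/f_inj.
by rewrite !linearZ linear0; apply/val_inj/aL/valP.
Qed.

Lemma reduced_sq N a (n : N) :
  reduced_module N -> a ^+ 2 *: n = 0 -> a *: n = 0.
Proof. by move=> redN /redN/(_ 1); rewrite mul1r. Qed.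

Lemma weakly_morphic_weakly_JT N :
  weakly_morphic N /\ reduced_module N -> weakly_JT_regular N.
Proof.
move=> [wmN redN]; apply/weakly_JTP => a n; apply/mulsubP.
apply: iso_kills_quotient (wmN (a ^+ 2)) _ n => x.
by rewrite inE => /eqP/reduced_sq; apply.
Qed.

Lemma morphic_weakly_JT N :
  morphic N /\ reduced_module N -> weakly_JT_regular N.
Proof.
move=> [mN redN]; apply/weakly_JTP => a n; apply/asboolP.
apply: iso_kills_quotient (mN ( *:%R (a ^+ 2))) _ n => x.
by rewrite inE => /eqP/reduced_sq; apply.
Qed.

(** A complement [L] of [N a] is killed by [a], as [L a] lies in both. *)
Lemma summand_sq N (K : submodClosed N) a :
    direct_summand K -> (forall x, x \in K <-> exists m, x = a *: m) ->
  forall n : N, exists m, a *: n = a ^+ 2 *: m.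
Proof.
move=> [L [KL0 KLN]] KE n; have [k [l [/KE[m ->] lL ->]]] := KLN n.
have al0 : a *: l = 0 by apply: KL0; [apply/KE; exists l | exact: rpredZ].
by exists m; rewrite scalerDr al0 addr0 scalerA.
Qed.

Lemma weakly_endoregular_weakly_JT N :
  weakly_endoregular N -> weakly_JT_regular N.
Proof.
move=> weN; apply/weakly_JTP => a n; apply: summand_sq (weN a).1 _ n => x.
by split=> /mulsubP.
Qed.

Lemma endoregular_weakly_JT N : endoregular N -> weakly_JT_regular N.
Proof.
move=> eN; apply/weakly_JTP => a n; apply: summand_sq (eN ( *:%R a)).1 _ n => x.
by split=> /asboolP.
Qed.

Lemma abelian_endoregular_weakly_JT N :
  abelian_endoregular N -> weakly_JT_regular N.
Proof.
move=> aeN; apply/weakly_JTP => a n; have [y ay] := aeN ( *:%R a).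
by exists (y n); rewrite ay /= scalerA.
Qed.

Lemma co_reduced_weakly_JT N : co_reduced N -> weakly_JT_regular N.
Proof. by move=> crN a; apply: crN. Qed.

Lemma strongly_F_regular_weakly_JT N :
  finitely_generated N -> strongly_F_regular N -> weakly_JT_regular N.
Proof.
move=> [s sN] sfN; apply/weakly_JTP => a n.
apply: (@summand_sq _ (mulsub N a)) => [|x]; last by split=> /mulsubP.
have aN x : a *: x \in mulsub N a by apply/mulsubP; exists x.
apply: sfN; pose t := [seq (Submod (aN x) : submod (mulsub N a)) | x <- s].
have tN : size t = size s by rewrite size_map.
exists t; rewrite tN => z; have /mulsubP[x zE] := valP z; have [c xE] := sN x.
exists c; apply: val_inj; rewrite zE xE scaler_sumr.
rewrite (linear_sum (submod_incl (mulsub N a))) /=; apply: eq_bigr => i _.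
by rewrite (nth_map 0) //= !scalerA mulrC.
Qed.

(** For [b] with [R (a n) = N b = N b^2], an element [b y] acts as the identity
on [N b], and [b y n] is a multiple [r a n]; hence [a n = b y a n = a r a n]. *)
Lemma JT_ann_regular N :
  finitely_generated N -> JT_regular N -> ann_regular N.
Proof.
move=> N_fg jtN; apply: fg_pointwise_regular => // a n.
have [b [nb bb]] := jtN (a *: n).
have [m|y bE] := @square_stable_regular _ N b N_fg.
  by apply/mulsubP; rewrite -bb; apply/mulsubP; exists m.
have /mulsubP[m anE] : a *: n \in mulsub N b.
  by rewrite -nb cycsub_gen.
have /cycsubP[r ynE] : (b * y) *: n \in cycsub (a *: n).
  by rewrite nb; apply/mulsubP; exists (y *: n); rewrite scalerA.
exists r; transitivity ((b * y) *: (a *: n)).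
  by rewrite anE scalerA -bE.
by rewrite scalerA [b * y * a]mulrC -(scalerA a) ynE !scalerA.
Qed.
End ToAnnRegular.

Lemma quotmod_piZ (R : comNzRingType) (N : lmodType R) (K : submodClosed N)
  (a : R) (n : N) : quotmod_pi K (a *: n) = a *: quotmod_pi K n.
Proof. exact: linearZ_LR. Qed.

Section PureTensor.
Variables (R : comNzRingType) (U V : lmodType R).

Definition pure_tensor_l (v : V) (u : U) : tensor U V := pure_tensor u v.

HB.instance Definition _ v := GRing.isLinear.Build R U (tensor U V) *:%R
  (pure_tensor_l v) (@pure_tensor_linearl R U V v).
HB.instance Definition _ u := GRing.isLinear.Build R V (tensor U V) *:%R
  (@pure_tensor R U V u) (@pure_tensor_linearr R U V u).

Lemma pure_tensorZl (a : R) (u : U) (v : V) :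
  pure_tensor (a *: u) v = a *: pure_tensor u v.
Proof. exact: (linearZ_LR (pure_tensor_l v)). Qed.

Lemma pure_tensor0l (v : V) : pure_tensor (0 : U) v = 0.
Proof. exact: (linear0 (pure_tensor_l v)). Qed.

Lemma pure_tensorZr (a : R) (u : U) (v : V) :
  pure_tensor u (a *: v) = a *: pure_tensor u v.
Proof. exact: linearZ_LR. Qed.

Lemma tensorP (t : tensor U V) :
  exists s : seq (U * V), t = \sum_(p <- s) pure_tensor p.1 p.2.
Proof.
elim/quotmodW: t => x.
exists [seq (coeff z x *: z.1, z.2) | z <- dom x]; rewrite big_map.
rewrite -{1}[x]freeg_sumE linear_sum; apply: eq_bigr => -[u v] _ /=.
rewrite pure_tensorZl /pure_tensor -linearZ; congr (quotmod_pi _ _).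
by apply/eqP/freeg_eqP => w; rewrite coeffU [RHS]coeff_fgscale coeffU mul1r.
Qed.
End PureTensor.

(** The test module for F-regularity is [E = R / R a]: in the tensor product of
[N] and [E] the tensor of [a n] and 1 is that of [n] and [a], which is 0.  By
F-regularity it is already 0 in the tensor product of [N a] and [E], which
[scale_mod] maps to [N / N a^2], sending it to the class of [a n]. *)
Section FRegular.
Variables (R : comNzRingType) (N : lmodType R) (a : R).

Let kills (x : submod (mulsub N a)) (r : R^o) : r \in mulsub R^o a ->
  scale_at (quotmod_pi (mulsub N (a ^+ 2)) (val x)) r = 0.
Proof.
case/mulsubP=> r' ->; have /mulsubP[m ->] := valP x.
rewrite linearZ_LR /= /scale_at -!quotmod_piZ; apply/eqP.
rewrite quotmod_pi_eq0; apply/mulsubP; exists (r' *: m).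
by rewrite !scalerA; congr (_ *: _); ring.
Qed.

Definition scale_mod (x : submod (mulsub N a)) (r : quotmod (mulsub R^o a)) :=
  quot_lift (kills x) r.

Lemma scale_modE x (r : R) :
  scale_mod x (quotmod_pi (mulsub R^o a) r) = r *: quotmod_pi _ (val x).
Proof. exact: (quot_liftE (kills x)). Qed.

Lemma scale_mod_linearl r : linear (scale_mod^~ r).
Proof.
elim/quotmodW: r => r b x y; rewrite !scale_modE.
have -> : val (b *: x + y) = b *: val x + val y by [].
by rewrite (linearP (quotmod_pi _)) scalerDr !scalerA [r * b]mulrC.
Qed.

Lemma scale_mod_linearr x : linear (scale_mod x).
Proof. exact: (quot_lift_is_linear (kills x)). Qed.

Lemma F_regular_sq (n : N) : F_regular N -> exists m, a *: n = a ^+ 2 *: m.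
Proof.
move=> fN; apply/mulsubP; rewrite -quotmod_pi_eq0; apply/eqP.
have an : a *: n \in mulsub N a by apply/mulsubP; exists n.
pose one := quotmod_pi (mulsub R^o a) 1.
have t0 : pure_tensor (Submod an) one = pure_tensor 0 one.
  apply: (fN (mulsub N a) (quotmod (mulsub R^o a))).
  rewrite !tensor_mapE linear0 [submod_incl _ _]/=.
  rewrite !(pure_tensorZl, pure_tensor0l).
  rewrite -pure_tensorZr -quotmod_piZ.
  have /eqP -> : quotmod_pi (mulsub R^o a) (a *: 1) == 0.
    by rewrite quotmod_pi_eq0; apply/mulsubP; exists 1.
  by rewrite linear0.
have := tensor_liftE scale_mod_linearl scale_mod_linearr (Submod an) one.
rewrite t0 (tensor_liftE scale_mod_linearl scale_mod_linearr).
by rewrite !(scale_modE _ (1 : R)) !scale1r linear0.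
Qed.
End FRegular.

Section MaximalIdeals.
Variable R : comNzRingType.

Lemma ex_maximal_ideal (A : submodClosed R^o) : (1 : R) \notin A ->
  exists2 m : idealr R, maximal_ideal m & {subset A <= m}.
Proof.
move=> A1.
(* Zorn is applied to boolean predicates rather than to the bundled type of
   proper ideals, whose universe is too large for it. *)
pose above (J : R -> bool) := idealr_closed J /\ {subset A <= J}.
have A_above : above [pred r : R | r \in A].
  split=> //; split=> [||a x y xA yA]; [exact: (rpred0 A) | exact: A1 |].
  exact: (rpredD (rpredZ a xA) yA).
pose le (J K : {J | above J}) := `[< {subset sval J <= sval K} >].
have [||C totC|[m [m_ideal Am]] m_max] :=
    @ZL_preorder {J | above J} (exist _ _ A_above) le.
- by move=> J; apply/asboolP.
- by move=> J K L /asboolP JK /asboolP KL; apply/asboolP => r /JK/KL.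
- have [[J0 CJ0]|C0] := pselect (exists J, C J); last first.
    by exists (exist _ _ A_above) => J CJ; case: C0; exists J.
  pose U r := `[< exists2 J, C J & r \in sval J >].
  have U_above : above U.
    split=> [|r rA]; last first.
      by apply/asboolP; exists J0 => //; apply: (svalP J0).2.
    split=> [||a x y /asboolP[J CJ xJ] /asboolP[K CK yK]].
    + by apply/asboolP; exists J0 => //; have [[]] := svalP J0.
    + by apply/asboolP => -[J _]; have [[_ /negP]] := svalP J.
    + apply/asboolP; have [/asboolP JK|/asboolP KJ] := totC J K CJ CK.
        by exists K => //; have [[_ _ +] _] := svalP K; apply=> //; apply: JK.
      by exists J => //; have [[_ _ +] _] := svalP J; apply=> //; apply: KJ.
  exists (exist _ U U_above) => J CJ; apply/asboolP => r rJ.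
  by apply/asboolP; exists J.
exists (HB.pack_for (idealr R) m (isIdealr.Build R m m_ideal)) => // J mJ.
have J_above : above J.
  split; last by move=> r /Am/mJ.
  split; [exact: idealr0 | by rewrite idealr1 |].
  by move=> a x y xJ yJ; rewrite rpredD // idealMr.
by have /asboolP := m_max (exist _ _ J_above) (asboolT mJ).
Qed.
End MaximalIdeals.

Section LocalSubmodule.
Variables (R : comNzRingType) (S : mulrClosed R) (N : lmodType R) (a : R).

Definition loc_mulsub : {pred locmod S N} :=
  [pred x | `[< exists n s, x = locfrac (a *: n) s >]].

Lemma loc_mulsub_submod : @submod_closed (locring S) (locmod S N) loc_mulsub.
Proof.
split=> [|c x y /asboolP[n [s ->]] /asboolP[m [t ->]]]; apply/asboolP.
  by exists 0, (denom1 S); rewrite scaler0.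
elim/locfracW: c => r w; exists (sval t *: (r *: n) + sval (denomM w s) *: m).
exists (denomM (denomM w s) t).
transitivity (locfrac (r *: (a *: n)) (denomM w s) + locfrac (a *: m) t).
  by congr (_ + _); apply: loc_scaleE.
rewrite locfracD; congr locfrac; rewrite scalerDr !scalerA.
by congr (_ *: _ + _ *: _); ring.
Qed.

HB.instance Definition _ := GRing.isSubmodClosed.Build (locring S) (locmod S N)
  loc_mulsub loc_mulsub_submod.
End LocalSubmodule.

Section AlmostLocallySimple.
Variable R : comNzRingType.
Implicit Types (N : lmodType R).

Lemma locfrac0P N (S : mulrClosed R) (n : N) s :
  locfrac n s = 0 :> locmod S N <-> exists2 u, u \in S & u *: n = 0.
Proof.
rewrite [0]/(locfrac 0 (denom1 S)) locfrac_eqP; split=> -[u uS un].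
  by exists u; rewrite // -[n]scale1r un !scaler0.
by exists u; rewrite // scale1r un !scaler0.
Qed.

(** If [r a n \in N a^2] only for [r] in a proper ideal, localize at a maximal
ideal above it: [a n] stays nonzero, so the image of [a] is the whole simple
module, which makes some [u \notin m] put [u a n] into [N a^2]. *)
Lemma almost_locally_simple_weakly_JT N :
  almost_locally_simple N -> weakly_JT_regular N.
Proof.
move=> alsN; apply/weakly_JTP => a n; apply/mulsubP.
pose A := transporter (mulsub N (a ^+ 2)) (a *: n).
have [A1|A1] := boolP ((1 : R^o) \in A); first by rewrite -[_ *: n]scale1r.
have [m m_max Am] := @ex_maximal_ideal R A A1.
have outA u : u \in compl_mulrClosed m_max ->
    u *: (a *: n) \notin mulsub N (a ^+ 2).
  by move=> /negP um; apply/negP => uA; apply: um; apply: Am.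
have an0 s : locfrac (a *: n) s <> 0 :> locmod (compl_mulrClosed m_max) N.
  move=> /locfrac0P[u /outA/negP uA uan]; apply: uA.
  by rewrite uan rpred0.
case: (alsN m m_max) => [N0|[_ simpN]]; first by case: (an0 (denom1 _)).
have [K0|KN] := simpN (@loc_mulsub R (compl_mulrClosed m_max) N a).
  case: (an0 (denom1 _)); apply: K0.
  by apply/asboolP; exists n, (denom1 _).
have /asboolP[x [s]] := KN (locfrac n (denom1 _)).
rewrite locfrac_eqP => -[u uS uE].
have /negP[] := outA _ (rpredM uS (svalP s)).
apply/mulsubP; exists (u *: x).
transitivity (a *: (u *: (sval s *: n))).
  by rewrite !scalerA mulrC mulrA.
by rewrite uE /= scale1r !scalerA; congr (_ *: _); ring.
Qed.
End AlmostLocallySimple.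

(** * Scalars acting regularly give each property *)

Section LocalUnits.
Variable R : comNzRingType.
Implicit Types (N : lmodType R) (a e y : R).

Definition local_units N : Prop :=
  forall (K : submodClosed N) (s : seq N), {in s, forall x, x \in K} ->
  exists2 e, forall n : N, e *: n \in K & {in s, forall x, e *: x = x}.

(** By [common_unit] a single [x] is enough.  Write [x R = N A] and [x] as a sum
of products of elements of [A] and of [N]; regularity gives for each product a
scalar of [A] fixing it, and a common one, [e], fixes [x] and satisfies
[N e <= N A = x R]. *)
Lemma ann_regular_local_units N :
  multiplication_module N -> ann_regular N -> local_units N.
Proof.
move=> multN regN K s sK.
have [|e /conductorP eK es] := @common_unit _ N (conductor K) s;
  last by exists e.
move=> x xs; have [A AE] := multN (cycsub x).
have /AE[t tA xE] := cycsub_gen x.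
have [|e eA et] := @common_unit _ N A [seq p.1 *: p.2 | p <- t].
  move=> _ /mapP[p /tA pA ->]; have [y py] := regN p.1.
  exists (y * p.1); first exact: (rpredZ y pA).
  by rewrite scalerA py; congr (_ *: _); ring.
exists e; last first.
  rewrite xE scaler_sumr; apply: eq_big_seq => p pt.
  by apply: et; apply: (map_f (fun p : R^o * N => p.1 *: p.2)).
apply/conductorP => n; have /cycsubP[r ->] : e *: n \in cycsub x.
  apply/AE; exists [:: (e, n)]; last by rewrite big_seq1.
  by move=> p; rewrite inE => /eqP ->.
by rewrite rpredZ ?sK.
Qed.

Lemma local_unit_at N (n : N) : local_units N ->
  exists2 e, forall x : N, e *: x \in cycsub n & e *: n = n.
Proof.
move=> unitN; have [|e en enn] := unitN (cycsub n) [:: n].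
  by move=> z; rewrite inE => /eqP ->; apply: cycsub_gen.
by exists e => //; rewrite enn // mem_head.
Qed.

Definition cyclic_module N : Prop :=
  exists g : N, forall x, exists r, x = r *: g.

(** Generators [x] and [g] are replaced by one: with [e] a unit for [x R], the
element [h = x + (1 - e) g] generates [x = e h], then [(1 - e) g = h - x], and
[e g] is a multiple of [x]. *)
Lemma local_units_cyclic N :
  finitely_generated N -> local_units N -> cyclic_module N.
Proof.
move=> [s sN] unitN.
suff [g gs] : exists g : N, {in s, forall x, x \in cycsub g}.
  exists g => x; apply/cycsubP; have [c ->] := sN x.
  by apply: rpred_sum => i _; rewrite rpredZ ?gs ?mem_nth.
elim: {sN}s => [|x s [g gs]]; first by exists 0.
have [e ex exx] := local_unit_at x unitN.
pose h := x + (g - e *: g).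
have eh : e *: h = x.
  have /cycsubP[r egE] := ex g.
  rewrite scalerDr scalerBr exx egE scalerA [e * r]mulrC -scalerA exx.
  by rewrite subrr addr0.
have xh : x \in cycsub h by apply/cycsubP; exists e.
exists h => z /predU1P[->//|/gs/cycsubP[r ->]]; apply: rpredZ.
have /cycsubP[q egE] := ex g; have -> : g = (h - x) + q *: x.
  by rewrite /h -egE [x + _]addrC addrK subrK.
by rewrite rpredD ?rpredZ // submodB // cycsub_gen.
Qed.

Lemma cyclic_endo N (f : {linear N -> N}) :
  cyclic_module N -> exists a, forall x, f x = a *: x.
Proof.
move=> [g gN]; have [a fg] := gN (f g); exists a => x; have [r ->] := gN x.
by rewrite linearZ_LR fg !scalerA mulrC.
Qed.

Lemma cyclic_finitely_generated N : cyclic_module N -> finitely_generated N.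
Proof.
move=> [g gN]; exists [:: g] => x; have [r ->] := gN x.
by exists (fun=> r); rewrite big_ord1.
Qed.

Lemma cyclic_multiplication N : cyclic_module N -> multiplication_module N.
Proof.
move=> [g gN] K; pose A : submodClosed R^o := transporter K g.
exists A => x; split=> [|[s sA ->]].
  have [r ->] := gN x => rK; exists [:: (r : R^o, g)]; last by rewrite big_seq1.
  by move=> p; rewrite inE => /eqP ->.
rewrite big_seq; apply: rpred_sum => p /sA pA; have [r ->] := gN p.2.
by rewrite scalerA mulrC -scalerA rpredZ.
Qed.

Lemma ann_regular_reduced N : ann_regular N -> reduced_module N.
Proof.
move=> regN a n an0 r; have [y ay] := regN a.
rewrite -scalerA ay (_ : a * y * a = y * a ^+ 2); last by ring.
by rewrite -scalerA an0 !scaler0.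
Qed.

(** [1 - y a] acts as a projection onto [l_N(a)] with kernel [N a]. *)
Lemma ann_regular_iso N (K L : submodClosed N) a : ann_regular N ->
    (forall x, x \in K <-> exists m, x = a *: m) ->
    (forall x, x \in L <-> a *: x = 0) ->
  isomorphic (quotmod K) (submod L).
Proof.
move=> regN KE LE; have [y ay] := regN a; pose u := 1 - y * a.
have uL n : u *: n \in L.
  apply/LE; rewrite scalerA.
  rewrite (_ : a * u = a - a * y * a); last by rewrite /u; ring.
  by rewrite scalerBl -ay subrr.
pose p : {linear N -> submod L} :=
  corestrict (f := ( *:%R u : {linear N -> N})) uL.
have pK x : x \in K -> p x = 0.
  move=> /KE[m ->]; apply: val_inj => /=.
  rewrite scalerA (_ : u * a = a - a * y * a); last by rewrite /u; ring.
  by rewrite scalerBl -ay subrr.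
exists (quot_lift pK : {linear quotmod K -> submod L}).
exists (fun x => quotmod_pi K (val x)) => [|x].
  elim/quotmodW=> n; transitivity (quotmod_pi K (u *: n)).
    by have /(congr1 (fun z => quotmod_pi K (val z))) := quot_liftE pK n.
  apply/quotmod_eq.
  apply/KE; exists (- (y *: n)).
  by rewrite scalerN scalerBl scale1r addrAC subrr add0r scalerA mulrC.
apply/val_inj; transitivity (u *: val x).
  by have /(congr1 val) := quot_liftE pK (val x).
have /LE xL := valP x.
by rewrite scalerBl scale1r -scalerA xL scaler0 subr0.
Qed.

Lemma ann_regular_summands N a : ann_regular N ->
  direct_summand (mulsub N a) /\ direct_summand (annsub N a).
Proof.
move=> regN; have [y ay] := regN a.
have disj x : x \in mulsub N a -> x \in annsub N a -> x = 0.
  move=> /mulsubP[m ->]; rewrite inE => /eqP am.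
  by rewrite ay -scalerA [a * y]mulrC -scalerA am scaler0.
have dec x : exists k l, [/\ k \in mulsub N a, l \in annsub N a & x = k + l].
  exists (a *: (y *: x)), (x - a *: (y *: x)); split.
  - by apply/mulsubP; exists (y *: x).
  - rewrite inE scalerBr subr_eq0 [_ *: x]ay !scalerA.
    by apply/eqP; congr (_ *: _); ring.
  - by rewrite addrC subrK.
split; [exists (annsub N a : submodClosed N) |
        exists (mulsub N a : submodClosed N)]; split=> // x.
  by move=> ? ?; apply: disj.
by have [k [l [? ? ->]]] := dec x; exists l, k; split=> //; rewrite addrC.
Qed.

Lemma direct_summand_ext N (K L : submodClosed N) :
  K =i L -> direct_summand K -> direct_summand L.
Proof.
move=> KL [P [KP0 KPN]]; exists P; split=> x; first by rewrite -KL; apply: KP0.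
by have [k [l []]] := KPN x; rewrite KL; exists k, l.
Qed.

Lemma ann_regular_endoregular N :
  cyclic_module N -> ann_regular N -> endoregular N.
Proof.
move=> cycN regN f; have [a fa] := cyclic_endo f cycN.
have [imN kerN] := ann_regular_summands a regN.
split; [apply: direct_summand_ext imN | apply: direct_summand_ext kerN] => x.
  by apply/asboolP/asboolP => -[m ->]; exists m; rewrite fa.
by rewrite !inE fa.
Qed.

Lemma ann_regular_morphic N : cyclic_module N -> ann_regular N -> morphic N.
Proof.
move=> cycN regN f; have [a fa] := cyclic_endo f cycN.
apply: (ann_regular_iso (a := a)) => // x; last first.
  by rewrite inE fa; split=> /eqP.
by split=> [/asboolP|] [m ->]; [|apply/asboolP]; exists m; rewrite fa.
Qed.

Lemma ann_regular_weakly_morphic N : ann_regular N -> weakly_morphic N.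
Proof.
move=> regN a; apply: (ann_regular_iso (a := a)) => // x.
  by split=> /mulsubP.
by rewrite inE; split=> /eqP.
Qed.

Lemma ann_regular_abelian_endoregular N :
  cyclic_module N -> ann_regular N -> abelian_endoregular N.
Proof.
move=> cycN regN t; have [a ta] := cyclic_endo t cycN; have [y ay] := regN a.
exists ( *:%R y : {linear N -> N}) => n; rewrite /= !ta ay !scalerA.
by congr (_ *: _); ring.
Qed.

Lemma ann_regular_co_reduced N : ann_regular N -> co_reduced N.
Proof.
move=> regN a k k0 n; have [y ay] := regN a.
have aX i (x : N) : a *: x = (a ^+ i.+1 * y ^+ i) *: x.
  elim: i x => [|i IHi] x; first by rewrite expr0 expr1 mulr1.
  by rewrite ay -scalerA IHi scalerA !exprS; congr (_ *: _); ring.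
apply/mulsubP/mulsubP => -[m ->]; case: k k0 => // k _.
  by exists (y ^+ k *: m); rewrite scalerA -aX.
by exists (a ^+ k *: m); rewrite scalerA -exprS.
Qed.

Lemma local_units_JT N : local_units N -> JT_regular N.
Proof.
move=> unitN n; have [e en enn] := local_unit_at n unitN.
have nE : cycsub n =i mulsub N e.
  move=> x; apply/cycsubP/mulsubP => -[r ->]; last by apply/cycsubP/en.
  by exists (r *: n); rewrite scalerA mulrC -scalerA enn.
exists e; split=> // x; rewrite -nE; apply/cycsubP/mulsubP => -[r ->].
  by exists (r *: n); rewrite scalerA mulrC -scalerA expr2 -scalerA !enn.
by apply/cycsubP; rewrite expr2 -scalerA.
Qed.

Lemma local_units_strongly_F_regular N : local_units N -> strongly_F_regular N.
Proof.
move=> unitN K [s sK].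
have [|e eK es] := unitN K [seq val x | x <- s].
  by move=> _ /mapP[x _ ->]; apply: valP.
have eid k : k \in K -> e *: k = k.
  move=> kK; have [c kE] := sK (Submod kK).
  rewrite -[k]/(submod_incl K (Submod kK)) kE linear_sum scaler_sumr.
  apply: eq_bigr => i _.
  rewrite (linearZ_LR (submod_incl K)) /= scalerA [e * _]mulrC -scalerA es //.
  by apply/mapP; exists s`_i; first exact: mem_nth.
exists (annsub N e : submodClosed N); split=> x.
  by move=> /eid xe; rewrite inE xe => /eqP.
exists (e *: x), (x - e *: x).
rewrite inE scalerBr [e *: (e *: x)]eid ?eK // subrr.
by split; rewrite ?eK // addrC subrK.
Qed.

(** An element of the tensor product of [K] and [E] involves finitely many
elements of [K]; multiplication by a unit [e] for them is a map from [N] to [K]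
which, tensored with [E], takes the image of that element back to it. *)
Lemma local_units_F_regular N : local_units N -> F_regular N.
Proof.
move=> unitN K E.
suff ker0 t : tensor_map (submod_incl K) E t = 0 -> t = 0.
  move=> t1 t2 t12; apply/eqP; rewrite -subr_eq0; apply/eqP/ker0.
  by rewrite linearB /= t12 subrr.
have [s ->] := tensorP t.
have [|e eK es] := unitN K [seq val p.1 | p <- s].
  by move=> _ /mapP[p _ ->]; apply: valP.
pose rho : {linear N -> submod K} :=
  corestrict (f := ( *:%R e : {linear N -> N})) eK.
move=> /(congr1 (tensor_map rho E)); rewrite linear0 !linear_sum => sum0.
rewrite -[RHS]sum0; apply: eq_big_seq => p ps /=.
rewrite !tensor_mapE; congr pure_tensor; apply: val_inj => /=.
by rewrite es //; apply/mapP; exists p.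
Qed.

(** Let [n / s] be a nonzero element of a submodule, and [e] a unit for [n R].
Since [1 - e] kills [n], it is in the maximal ideal, so [e] becomes invertible;
and [e x] is a multiple of [n] for each [x], so [n / s] generates. *)
Lemma local_units_almost_locally_simple N :
  local_units N -> almost_locally_simple N.
Proof.
move=> unitN m m_max.
set S := compl_mulrClosed m_max; pose N_m : lmodType (locring S) := locmod S N.
have [|Nn0] := pselect (zero_module N_m); [by left | right; split=> // K].
have [|/existsNP[v /not_implyP[vK v0]]] :=
  pselect (forall v, v \in K -> v = 0); [by left | right => w].
elim/locfracW: v vK v0 => n s vK v0; elim/locfracW: w => x t.
have [e en enn] := local_unit_at n unitN.
have eS : e \in S.
  apply/negP => em; apply: v0; apply/locfrac0P; exists (1 - e).
    apply/negP => em1; have := rpredD em em1.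
    by rewrite addrC subrK idealr1.
  by rewrite scalerBl scale1r enn subrr.
have /cycsubP[r exE] := en x.
pose se : denom S := exist _ e eS.
pose c : locring S := locfrac ((r * sval s) : R^o) (denomM se t).
suff -> : locfrac x t = c *: (locfrac n s : N_m) by apply: rpredZ.
rewrite [RHS]loc_scaleE; apply: locfrac_eq => /=.
transitivity ((sval t * sval s) *: (e *: x)).
  by rewrite scalerA; congr (_ *: _); ring.
by rewrite exE !scalerA; congr (_ *: _); ring.
Qed.
End LocalUnits.

(** * The characterizations *)

Section Characterizations.
Variable R : comNzRingType.
Implicit Types (N M : lmodType R).

Definition characterizes (P : lmodType R -> Prop) : Prop :=
  forall N, finitely_generated N -> multiplication_module N ->
  ann_regular N <-> P N.

Lemma characterizesI (P : lmodType R -> Prop) :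
    (forall N, finitely_generated N -> P N -> ann_regular N) ->
    (forall N, cyclic_module N -> local_units N -> ann_regular N -> P N) ->
  characterizes P.
Proof.
move=> Preg regP N N_fg multN; split=> [regN|]; last exact: Preg.
have unitN := ann_regular_local_units multN regN.
by apply: regP => //; apply: local_units_cyclic.
Qed.

Lemma characterizesJT (P : lmodType R -> Prop) :
    (forall N, finitely_generated N -> P N -> weakly_JT_regular N) ->
    (forall N, cyclic_module N -> local_units N -> ann_regular N -> P N) ->
  characterizes P.
Proof.
move=> PJT; apply: characterizesI => N N_fg /(PJT N N_fg).
exact: weakly_JT_ann_regular.
Qed.

(** Cyclic modules are finitely generated multiplication modules, so [P] may be
replaced by [ann_regular] on each cyclic submodule. *)
Lemma every_cyclic_ann_regular (P : lmodType R -> Prop) M :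
    characterizes P -> finitely_generated M ->
  ann_regular M <-> every_cyclic_submodule M P.
Proof.
move=> PE M_fg.
have cyc (n : M) : cyclic_module (submod (cycsub n)).
  exists (Submod (cycsub_gen n)) => x; have /cycsubP[r xE] := valP x.
  by exists r; apply: val_inj.
have cycE n := PE _ (cyclic_finitely_generated (cyc n))
                    (cyclic_multiplication (cyc n)).
split=> [regM n|H].
  apply/cycE => a; have [y ay] := regM a; exists y => x.
  by apply: val_inj; apply: ay.
apply: fg_pointwise_regular => // a n; have /cycE/(_ a)[y ay] := H n.
by exists y; have /(congr1 val) := ay (Submod (cycsub_gen n)).
Qed.

Lemma characterizes_weakly_morphic :
  characterizes (fun N => weakly_morphic N /\ reduced_module N).
Proof.
apply: characterizesJT => N; first by move=> _; apply: weakly_morphic_weakly_JT.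
by split; [apply: ann_regular_weakly_morphic | apply: ann_regular_reduced].
Qed.

Lemma characterizes_morphic :
  characterizes (fun N => morphic N /\ reduced_module N).
Proof.
apply: characterizesJT => N; first by move=> _; apply: morphic_weakly_JT.
by split; [apply: ann_regular_morphic | apply: ann_regular_reduced].
Qed.

Lemma characterizes_weakly_endoregular : characterizes (@weakly_endoregular R).
Proof.
apply: characterizesJT => N.
  by move=> _; apply: weakly_endoregular_weakly_JT.
by move=> _ _ regN a; apply: ann_regular_summands.
Qed.

Lemma characterizes_endoregular : characterizes (@endoregular R).
Proof.
apply: characterizesJT => N; first by move=> _; apply: endoregular_weakly_JT.
by move=> cycN _; apply: ann_regular_endoregular.
Qed.

Lemma characterizes_abelian_endoregular :
  characterizes (@abelian_endoregular R).
Proof.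
apply: characterizesJT => N.
  by move=> _; apply: abelian_endoregular_weakly_JT.
by move=> cycN _; apply: ann_regular_abelian_endoregular.
Qed.

Lemma characterizes_co_reduced : characterizes (@co_reduced R).
Proof.
apply: characterizesJT => N; first by move=> _; apply: co_reduced_weakly_JT.
by move=> _ _; apply: ann_regular_co_reduced.
Qed.

Lemma characterizes_JT : characterizes (@JT_regular R).
Proof.
apply: characterizesI => N; first exact: JT_ann_regular.
by move=> _ unitN _; apply: local_units_JT.
Qed.

Lemma characterizes_weakly_JT : characterizes (@weakly_JT_regular R).
Proof.
apply: characterizesJT => // N _ _ regN a.
exact: (ann_regular_co_reduced regN).
Qed.

Lemma characterizes_F_regular : characterizes (@F_regular R).
Proof.
apply: characterizesJT => N.
  by move=> _ fN; apply/weakly_JTP => a n; apply: F_regular_sq.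
by move=> _ unitN _; apply: local_units_F_regular.
Qed.

Lemma characterizes_strongly_F_regular : characterizes (@strongly_F_regular R).
Proof.
apply: characterizesJT => N; first exact: strongly_F_regular_weakly_JT.
by move=> _ unitN _; apply: local_units_strongly_F_regular.
Qed.

Lemma characterizes_almost_locally_simple :
  characterizes (@almost_locally_simple R).
Proof.
apply: characterizesJT => N.
  by move=> _; apply: almost_locally_simple_weakly_JT.
by move=> _ unitN _; apply: local_units_almost_locally_simple.
Qed.
End Characterizations.

Theorem proposition7 (R : comNzRingType) (M : lmodType R)
    (M_neq0 : nonzero_module M)
    (M_fg : finitely_generated M)
    (M_mult : multiplication_module M) :
  [<->
    (* (1) *)
    weakly_morphic M /\ reduced_module M;
    morphic M /\ reduced_module M;
    (* (2) *)
    regular_ring (Quotient.quot (Ann M_neq0));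
    (* (3) *)
    weakly_endoregular M;
    endoregular M;
    (* (4) *)
    endoregular M;
    abelian_endoregular M;
    (* (5) *)
    JT_regular M;
    weakly_JT_regular M;
    (* (6) *)
    almost_locally_simple M;
    (* (7) *)
    F_regular M;
    strongly_F_regular M;
    (* (8) *)
    every_cyclic_submodule M
      (fun C => weakly_morphic C /\ reduced_module C);
    every_cyclic_submodule M (fun C => morphic C /\ reduced_module C);
    every_cyclic_submodule M (@weakly_endoregular R);
    every_cyclic_submodule M (@endoregular R);
    every_cyclic_submodule M (@abelian_endoregular R);
    every_cyclic_submodule M (@co_reduced R);
    every_cyclic_submodule M (@JT_regular R);
    every_cyclic_submodule M (@weakly_JT_regular R);
    every_cyclic_submodule M (@F_regular R);
    every_cyclic_submodule M (@strongly_F_regular R);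
    every_cyclic_submodule M (@almost_locally_simple R)].
Proof.
pose Q := ann_regular M.
have via (P P' : Prop) : (Q <-> P) -> (Q <-> P') -> P -> P'.
  by move=> QP QP' /QP/QP'.
have E P (PE : characterizes P) : Q <-> P M by apply: PE.
have C P (PE : characterizes P) : Q <-> every_cyclic_submodule M P.
  exact: every_cyclic_ann_regular.
have wm := @characterizes_weakly_morphic R.
have mor := @characterizes_morphic R.
have we := @characterizes_weakly_endoregular R.
have en := @characterizes_endoregular R.
have ab := @characterizes_abelian_endoregular R.
have co := @characterizes_co_reduced R; have jt := @characterizes_JT R.
have wj := @characterizes_weakly_JT R; have fr := @characterizes_F_regular R.
have sf := @characterizes_strongly_F_regular R.
have al := @characterizes_almost_locally_simple R.
have quo := ann_regular_quotient M_neq0.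
tfae.
- exact: via (E _ wm) (E _ mor).
- exact: via (E _ mor) quo.
- exact: via quo (E _ we).
- exact: via (E _ we) (E _ en).
- by [].
- exact: via (E _ en) (E _ ab).
- exact: via (E _ ab) (E _ jt).
- exact: via (E _ jt) (E _ wj).
- exact: via (E _ wj) (E _ al).
- exact: via (E _ al) (E _ fr).
- exact: via (E _ fr) (E _ sf).
- exact: via (E _ sf) (C _ wm).
- exact: via (C _ wm) (C _ mor).
- exact: via (C _ mor) (C _ we).
- exact: via (C _ we) (C _ en).
- exact: via (C _ en) (C _ ab).
- exact: via (C _ ab) (C _ co).
- exact: via (C _ co) (C _ jt).
- exact: via (C _ jt) (C _ wj).
- exact: via (C _ wj) (C _ fr).
- exact: via (C _ fr) (C _ sf).
- exact: via (C _ sf) (C _ al).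
- exact: via (C _ al) (E _ wm).
Qed.
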